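(* Let $f:\mathbb{N}_0\to\mathbb{R}$ be a function satisfying $f(0)\ge 0$. Fix $\nu\in(0,1)$ and suppose that $${}^{C}\Delta_0^{\nu}f(t)\ge -\frac{t^{(-\nu)}}{\Gamma(1-\nu)}f(0)\quad\text{for each } t\in\mathbb{N}_{1-\nu}.$$ Then $f$ is $\nu$-increasing on $\mathbb{N}_0$.
   Context: For a real number $c$, $\mathbb{N}_c=\{c,c+1,c+2,\dots\}$. $\Delta f(t)=f(t+1)-f(t)$, $\sigma(s)=s+1$. The falling function is $x^{(\beta)}=\Gamma(x+1)/\Gamma(x+1-\beta)$, with the convention that division at a pole yields zero. For $0<\nu<1$ the delta left Caputo fractional difference starting from $0$ is $${}^{C}\Delta_0^{\nu}f(t)=\frac{1}{\Gamma(1-\nu)}\sum_{s=0}^{t-(1-\nu)}(t-\sigma(s))^{(-\nu)}\Delta f(s),\qquad t\in\mathbb{N}_{1-\nu}.$$ A function $y:\mathbb{N}_0\to\mathbb{R}$ satisfying $y(0)\ge 0$ is called $\nu$-increasing on $\mathbb{N}_0$ if $y(t+1)\ge\nu\,y(t)$ for all $t\in\mathbb{N}_0$. *)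

(* Defs.v *)
From mathcomp Require Import all_boot all_order all_algebra.
From mathcomp Require Import all_classical all_reals all_analysis.
Set Implicit Arguments.
Unset Strict Implicit.
Unset Printing Implicit Defensive.
Import Order.TTheory GRing.Theory Num.Theory.
Import numFieldNormedType.Exports.
Local Open Scope classical_set_scope.
Local Open Scope ring_scope.

Definition NN (R : realType) (c : R) : set R :=
  [set t | exists n : nat, t = c + n%:R].

Definition delta (R : realType) (f : nat -> R) (s : nat) : R := f s.+1 - f s.

Definition Gamma_pole (R : realType) (x : R) : bool := - x \is a Num.nat.

Definition Euler_integral (R : realType) (x : R) : R :=
  \int[lebesgue_measure]_(u in `]0, +oo[) (u `^ (x - 1) * expR (- u)).

(* For x <= 0, n is such that 0 < x + n, and Gamma is continued by
   Gamma(x) = Gamma(x + n) / (x (x + 1) ... (x + n - 1)).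
   The value at a pole is irrelevant (it is 0). *)
Definition Gamma (R : realType) (x : R) : R :=
  if 0 < x then Euler_integral x
  else let n := (Num.truncn (- x)).+1 in
       Euler_integral (x + n%:R) / \prod_(i < n) (x + i%:R).

Definition falling (R : realType) (x b : R) : R :=
  if Gamma_pole (x + 1 - b) then 0 else Gamma (x + 1) / Gamma (x + 1 - b).

(* Only meaningful for t in NN (1 - nu): then t - (1 - nu) is a natural
   number, which truncn returns as a nat; s ranges up to it, inclusive. *)
Definition Caputo (R : realType) (nu : R) (f : nat -> R) (t : R) : R :=
  (Gamma (1 - nu))^-1 *
  \sum_(0 <= s < (Num.truncn (t - (1 - nu))).+1)
     falling (t - s.+1%:R) (- nu) * delta f s.

Definition nu_increasing (R : realType) (nu : R) (y : nat -> R) : Prop :=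
  0 <= y 0%N /\ forall t : nat, nu * y t <= y t.+1.

(* Main.v *)
(** With w(k) = falling (k - nu) (-nu) = Gamma(k + 1 - nu) / Gamma(k + 1), the
    hypothesis at t = 1 - nu + n reads
      sum_(s <= n) w(n - s) (f(s + 1) - f(s)) + w(n + 1) f(0) >= 0,
    and summation by parts turns it into
      w(0) f(n + 1) >= sum_(s <= n) (w(n - s) - w(n - s + 1)) f(s).
    The functional equation of Gamma gives w(k + 1) = (1 - nu / (k + 1)) w(k),
    so all the coefficients are nonnegative and the one of f(n) is nu w(0):
    f >= 0 follows by strong induction, and then f(n + 1) >= nu f(n). *)
Require Import Defs.
From mathcomp Require Import all_boot all_order all_algebra.
From mathcomp Require Import all_classical all_reals all_analysis.
From mathcomp Require Import measurable_realfun ring.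
Import Order.TTheory GRing.Theory Num.Theory.
Import numFieldNormedType.Exports.
Local Open Scope classical_set_scope.
Local Open Scope ring_scope.

(** * Euler's integral: functional equation, finiteness and positivity *)

Local Notation gamma_kernel x u := (u `^ (x - 1) * expR (- u)).

(* With values in the extended reals, the functional equation needs no prior
   integrability; finiteness on ]0, 1] is then deduced from that on ]1, 2]. *)
Definition egamma (R : realType) (x : R) : \bar R :=
  (\int[lebesgue_measure]_(u in `]0%R, +oo[) (gamma_kernel x u)%:E)%E.

Lemma gamma_kernel_ge0 (R : realType) (x u : R) : 0 <= gamma_kernel x u.
Proof. by rewrite mulr_ge0 ?powR_ge0 ?expR_ge0. Qed.

Lemma measurable_gamma_kernel (R : realType) (D : set R) (x : R) :
  measurable_fun D (EFin \o (fun u : R => gamma_kernel x u)).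
Proof.
apply: measurable_funTS; apply/measurable_EFinP; apply: measurable_funM.
  exact: measurable_powR.
by apply: measurableT_comp; [exact: measurable_expR|exact: measurable_funN].
Qed.

Lemma derivable_right_oo_LRcontinuous (R : realType) (F : R -> R) (a b : R) :
  a < b -> (forall u, a <= u -> derivable F u 1) ->
  derivable_oo_LRcontinuous F a b.
Proof.
move=> ab dF.
have cF u : a <= u -> {for u, continuous F}.
  by move=> au; apply: differentiable_continuous; exact/derivable1_diffP/dF.
split.
- by move=> u; rewrite in_itv/= => /andP[/ltW au _]; exact: dF.
- exact/cvg_at_right_filter/cF.
- exact/cvg_at_left_filter/cF/ltW.
Qed.

Lemma is_derive_NexpRN (R : realType) (u : R) :
  is_derive u 1 (fun v : R => - expR (- v)) (expR (- u)).
Proof. by apply: is_derive_eq; rewrite mulrN1 opprK. Qed.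

(** Integrate u^x against the primitive -e^(-u) of e^(-u); staying away from 0 keeps u^x
    differentiable up to both endpoints. *)
Lemma integral_gamma_kernel_by_parts (R : realType) (x a b : R) :
  0 <= x -> 0 < a -> a < b ->
  (\int[lebesgue_measure]_(u in `[a, b]) (gamma_kernel (x + 1) u)%:E =
   (a `^ x * expR (- a) - b `^ x * expR (- b))%:E +
   x%:E * \int[lebesgue_measure]_(u in `[a, b]) (gamma_kernel x u)%:E)%E.
Proof.
move=> x0 a0 ab.
have pos u : a <= u -> 0 < u by exact: lt_le_trans.
have dpow y u : a <= u -> derivable (fun v : R => v `^ y) u 1.
  by move=> au; apply: ex_derive; apply: is_derive1_powR; exact: pos.
have dG u : derivable (fun v : R => - expR (- v)) u 1.
  by apply: ex_derive; exact: is_derive_NexpRN.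
have dF := derivable_right_oo_LRcontinuous _ _ _ _ ab (dpow x).
have ca : {within `[a, b], continuous (fun u => x * u `^ (x - 1))}.
  apply: derivable_oo_LRcontinuous_within.
  apply: derivable_right_oo_LRcontinuous => // u au.
  by apply: derivableM => //; exact: dpow.
have ce : {within `[a, b], continuous (fun u : R => expR (- u))}.
  apply: continuous_subspaceT => u; apply: continuous_comp; last exact: continuous_expR.
  exact: (@continuousN _ R^o).
rewrite addrK.
have := integration_by_parts ab ca dF _ ce
  (derivable_right_oo_LRcontinuous _ _ _ _ ab (fun u _ => dG u)) _.
move=> -> //; last 2 first.
- move=> u; rewrite in_itv/= => /andP[au _]; rewrite powR_derive1//.
  by rewrite in_itv/= andbT pos// ltW.
- move=> u _; rewrite derive1E; exact: (@derive_val _ _ _ _ _ _ _ (is_derive_NexpRN _ u)).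
rewrite -ge0_integralZl//; last 2 first.
- exact: measurable_gamma_kernel.
- by move=> u _; rewrite lee_fin gamma_kernel_ge0.
congr (_ + _)%E.
  by congr EFin; rewrite !mulrN opprK addrC.
(* What remains is minus the integral of x u^(x-1) (-e^(-u)); the constant sign of the integrand
   lets the two signs cancel in the extended reals. *)
rewrite -[RHS]oppeK -integral_ge0N => [|u _].
  by congr oppe; apply: eq_integral => u _; rewrite mulrN EFinN -mulrA EFinM.
by rewrite -EFinM lee_fin mulr_ge0// gamma_kernel_ge0.
Qed.

(** For an integer k >= x and m = n + 2, m^x <= m^k and e^m >= m^(k+1) / (k+1)!, so the term is at
    most (k+1)! / (n + 1). *)
Lemma expR_powR_cvg0 (R : realType) (x : R) :
  (n.+2%:R `^ x * expR (- n.+2%:R)) @[n --> \oo] --> (0 : R).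
Proof.
pose k := (Num.truncn x).+1.
have xk : x <= k%:R by apply/ltW; exact: truncnS_gt.
apply: (@squeeze_cvgr _ _ _ _ (fun=> 0) (fun n => (k.+1)`!%:R * harmonic n)); last 2 first.
- exact: cvg_cst.
- by rewrite -[X in _ --> X](mulr0 k.+1`!%:R); apply: cvgMr; exact: cvg_harmonic.
apply: nearW => n; rewrite mulr_ge0 ?powR_ge0 ?expR_ge0//=.
have n1 : (1 : R) <= n.+2%:R by rewrite ler1n.
have n0 : (0 : R) < n.+2%:R by rewrite ltr0n.
have := @expR_ge1Dxn R n.+2%:R k (ltW n0) => ek.
rewrite expRN ler_pdivrMr ?expR_gt0//.
apply: (@le_trans _ _ (n.+2%:R ^+ k)).
  by rewrite -powR_mulrn ?(ltW n0)//; exact: ler_powR.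
rewrite mulrAC ler_pdivlMr ?ltr0n//.
apply: (@le_trans _ _ (n.+2%:R ^+ k.+1)).
  by rewrite exprSr ler_wpM2l ?exprn_ge0// ?ler_nat// ltW.
rewrite mulrC -ler_pdivrMr ?ltr0n ?fact_gt0//.
by apply: le_trans ek; rewrite lerDr.
Qed.

(** The upper end n + 2 makes the interval nondegenerate already at n = 0, as integration by parts
    requires. *)
Lemma itv0y_bigcup (R : realType) :
  `]0%R, +oo[%classic = \bigcup_n `[(n.+1%:R)^-1, (n.+2%:R : R)]%classic.
Proof.
apply/seteqP; split => u /=; last first.
  by case=> n _; rewrite /= !in_itv/= andbT => /andP[+ _]; apply: lt_le_trans; rewrite invr_gt0 ltr0n.
rewrite in_itv/= andbT => u0.
(* The first entry ensures u <= n + 2, the second 1 / u <= n + 1. *)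
exists (maxn (Num.truncn u) (Num.truncn u^-1)) => //=.
rewrite in_itv/= invf_ple ?posrE ?ltr0n//; apply/andP; split.
  apply: ltW; apply: lt_le_trans (truncnS_gt _) _.
  by rewrite ler_nat ltnS leq_maxr.
apply: ltW; apply: lt_le_trans (truncnS_gt _) _.
by rewrite ler_nat ltnS leqW// leq_maxl.
Qed.

(** Monotone convergence: the limit holds whether or not it is finite. *)
Lemma cvg_truncated_egamma (R : realType) (x : R) :
  ((\int[lebesgue_measure]_(u in `[(n.+1%:R^-1)%R, (n.+2%:R)%R]) (gamma_kernel x u)%:E)%E
    @[n --> \oo] --> egamma R x).
Proof.
rewrite /egamma itv0y_bigcup.
apply: ge0_nondecreasing_set_cvg_integral => //.
- move=> m n mn; rewrite subsetEset => u /=; rewrite !in_itv/= => /andP[mu um].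
  apply/andP; split.
    by apply: le_trans mu; rewrite lef_pV2 ?posrE ?ltr0n// ler_nat.
  by apply: le_trans um _; rewrite ler_nat.
- by move=> n; exact: measurable_gamma_kernel.
- by move=> n u _; rewrite lee_fin gamma_kernel_ge0.
Qed.

Lemma harmonic_powR_expR_cvg0 (R : realType) (x : R) : 0 < x ->
  ((n.+1%:R)^-1 `^ x * expR (- (n.+1%:R)^-1)) @[n --> \oo] --> (0 : R).
Proof.
move=> x0.
have h : ((n.+1%:R : R)^-1 `^ x) @[n --> \oo] --> (0 : R).
  move/cvg_at_rightP : (@powR_cvg0 R _ x0); apply; split; last exact: cvg_harmonic.
  by move=> n; rewrite invr_gt0 ltr0n.
apply: (@squeeze_cvgr _ _ _ _ (fun=> 0) (fun n => (n.+1%:R)^-1 `^ x)); last 2 first.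
- exact: cvg_cst.
- exact: h.
apply: nearW => n; rewrite mulr_ge0 ?powR_ge0 ?expR_ge0//=.
by rewrite ler_piMr ?powR_ge0// expR_le1 oppr_le0 invr_ge0.
Qed.

Lemma egammaS (R : realType) (x : R) : 0 < x ->
  (egamma R (x + 1) = x%:E * egamma R x)%E.
Proof.
(* The added 0 is the limit of the boundary terms. *)
move=> x0; rewrite -[RHS]add0e.
rewrite -(cvg_lim (@ereal_hausdorff R) (cvg_truncated_egamma _ (x + 1))).
apply/cvg_lim; first exact: ereal_hausdorff.
under eq_fun.
  move=> n; rewrite integral_gamma_kernel_by_parts ?(ltW x0)// ?invr_gt0 ?ltr0n//; last first.
    by rewrite (@le_lt_trans _ _ 1)// ?ltr1n// invf_le1 ?ltr0n// ler1n.
  over.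
apply: cvgeD => //.
- apply: cvg_EFin; first exact: nearW.
  rewrite -[X in _ --> X](subr0 (0 : R)).
  by apply: cvgB; [exact: harmonic_powR_expR_cvg0|exact: expR_powR_cvg0].
- by apply: cvgeZl => //; exact: cvg_truncated_egamma.
Qed.

Lemma egamma1 (R : realType) : egamma R 1 = 1%E.
Proof.
rewrite /egamma subrr.
rewrite integral_itv_obnd_cbnd; last first.
  by rewrite -(subrr 1); exact: measurable_gamma_kernel.
under eq_integral do rewrite powRr0 mul1r.
rewrite (@ge0_continuous_FTC2y _ _ (fun v => - expR (- v)) _ 0).
- by rewrite oppr0 expR0 EFinN oppeK add0e.
- by move=> u _; exact: expR_ge0.
- apply: continuous_subspaceT => u; apply: continuous_comp; last exact: continuous_expR.
  exact: (@continuousN _ R^o).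
- by rewrite -[X in _ --> X]oppr0; apply: cvgN; exact: cvgr_expR.
- by move=> u _; apply: ex_derive; exact: is_derive_NexpRN.
- apply: cvgN; apply/cvg_at_right_filter; apply: continuous_comp; last exact: continuous_expR.
  exact: (@continuousN _ R^o).
- move=> u _; rewrite derive1E; exact: (@derive_val _ _ _ _ _ _ _ (is_derive_NexpRN _ u)).
Qed.

Lemma egamma2 (R : realType) : egamma R (1 + 1) = 1%E.
Proof. by rewrite egammaS// egamma1 mule1. Qed.

(** Since x > 0, finiteness at x + 1 passes to x by the functional equation. At x + 1, the bound u^x
    <= 1 + u dominates the kernel by those at 1 and 2. *)
Lemma egamma_lty (R : realType) (x : R) : 0 < x <= 1 -> (egamma R x < +oo)%E.
Proof.
move=> /andP[x0 x1].
suff : (egamma R (x + 1) < +oo)%E.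
  by rewrite egammaS//; case: (egamma R x) => [r| |]; rewrite ?ltry// gt0_muley ?lte_fin.
apply: (@le_lt_trans _ _ (egamma R 1 + egamma R (1 + 1))%E); last first.
  by rewrite egamma1 egamma2 -EFinD ltry.
rewrite /egamma -ge0_integralD//; last 4 first.
- by move=> u _; rewrite lee_fin gamma_kernel_ge0.
- exact: measurable_gamma_kernel.
- by move=> u _; rewrite lee_fin gamma_kernel_ge0.
- exact: measurable_gamma_kernel.
apply: ge0_le_integral => //.
- by move=> u _; rewrite lee_fin gamma_kernel_ge0.
- exact: measurable_gamma_kernel.
- by apply: emeasurable_funD; exact: measurable_gamma_kernel.
move=> u; rewrite /= in_itv/= andbT => u0.
rewrite -EFinD lee_fin -mulrDl ler_wpM2r ?expR_ge0// !addrK subrr powRr0 powRr1 ?(ltW u0)//.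
have [u1|/ltW u1] := leP 1 u.
  by rewrite (le_trans (ler1_powR u1 x1))// lerDr.
rewrite (@le_trans _ _ 1)// ?lerDl ?(ltW u0)//.
by rewrite -[leRHS](powRr0 u) ger_powR// ?u0// ltW.
Qed.

(** On ]0, 1] the kernel is at least e^(-1), because u^(x-1) >= 1 there. *)
Lemma egamma_gt0 (R : realType) (x : R) : 0 < x <= 1 -> (0 < egamma R x)%E.
Proof.
move=> /andP[x0 x1].
apply: (@lt_le_trans _ _ (\int[lebesgue_measure]_(u in `]0%R, 1%R]) (cst (expR (- 1))%:E u))%E).
  rewrite integral_cst//= lebesgue_measure_itv/= lte_fin ltr01 oppr0 adde0 mule1.
  by rewrite lte_fin expR_gt0.
apply: (@le_trans _ _ (\int[lebesgue_measure]_(u in `]0%R, 1%R]) (gamma_kernel x u)%:E)%E).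
  apply: ge0_le_integral => //.
  - by move=> u _; rewrite lee_fin expR_ge0.
  - exact: measurable_gamma_kernel.
  move=> u; rewrite /= in_itv/= => /andP[u0 u1].
  rewrite lee_fin -[leLHS]mul1r ler_pM// ?expR_ge0//.
    by rewrite -[leLHS](powRr0 u) ger_powR ?u0// subr_le0.
  by rewrite ler_expR lerN2.
apply: ge0_subset_integral => //.
- exact: measurable_gamma_kernel.
- by move=> u _; rewrite lee_fin gamma_kernel_ge0.
- by move=> u/=; rewrite !in_itv/= andbT => /andP[].
Qed.

(** * Recurrence and positivity of [Gamma] on the positive reals *)

Lemma Gamma_egamma (R : realType) (x : R) : 0 < x -> Gamma x = fine (egamma R x).
Proof. by move=> x0; rewrite /Gamma x0. Qed.

Lemma GammaS (R : realType) (x : R) : 0 < x -> Gamma (x + 1) = x * Gamma x.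
Proof.
move=> x0; rewrite !Gamma_egamma ?addr_gt0// egammaS//.
(* [fine] sends infinite values to 0, so the identity survives in those cases too. *)
by case: (egamma R x) => [r| |] //; rewrite ?gt0_muley ?gt0_muleNy ?lte_fin// mulr0.
Qed.

(** The recurrence lowers x by 1 until it lies in ]0, 1], where the integral is both positive and
    finite. *)
Lemma Gamma_gt0 (R : realType) (x : R) : 0 < x -> 0 < Gamma x.
Proof.
move=> x0; have := truncnS_gt x; move: (Num.truncn x) => n /ltW.
elim: n x x0 => [|n IHn] x x0 xn.
  by rewrite Gamma_egamma// fine_gt0// egamma_gt0 ?egamma_lty ?x0.
have [x1|x1] := leP x 1.
  by rewrite Gamma_egamma// fine_gt0// egamma_gt0 ?egamma_lty ?x0.
rewrite -(subrK 1 x) GammaS ?subr_gt0// mulr_gt0 ?subr_gt0// IHn ?subr_gt0//.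
by rewrite lerBlDr natr1.
Qed.

(** * The weights w(k) *)

Lemma falling_natB (R : realType) (nu : R) (k : nat) :
  falling (k%:R - nu) (- nu) = Gamma (k.+1%:R - nu) / Gamma k.+1%:R.
Proof.
have E : k%:R - nu + 1 = k.+1%:R - nu by rewrite addrAC natr1.
rewrite /falling /Gamma_pole opprK E subrK ifN//.
(* The denominator is taken at k + 1 > 0, which is not a pole. *)
by apply/negP => /natr_ge0; rewrite oppr_ge0 lern0.
Qed.

Lemma falling_natB_gt0 (R : realType) (nu : R) (k : nat) :
  nu < 1 -> 0 < falling (k%:R - nu) (- nu).
Proof.
move=> nu1; rewrite falling_natB divr_gt0 ?Gamma_gt0//.
by rewrite subr_gt0 (lt_le_trans nu1)// ler1n.
Qed.

Lemma falling_natBS (R : realType) (nu : R) (k : nat) : nu < 1 ->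
  falling (k.+1%:R - nu) (- nu) =
  (1 - nu / k.+1%:R) * falling (k%:R - nu) (- nu).
Proof.
move=> nu1; rewrite !falling_natB.
have k0 : (0 : R) < k.+1%:R by [].
have knu0 : 0 < k.+1%:R - nu by rewrite subr_gt0 (lt_le_trans nu1)// ler1n.
rewrite -[k.+2%:R]natr1 addrAC !GammaS//.
have G0 := lt0r_neq0 (Gamma_gt0 _ _ k0); have k0' := lt0r_neq0 k0.
by field; rewrite G0 nat1r.
Qed.

(** * Summation by parts and the induction *)

Lemma sum_by_parts_delta (R : realType) (w f : nat -> R) (n : nat) :
  \sum_(0 <= s < n.+1) w (n - s)%N * delta f s + w n.+1 * f 0%N =
  w 0%N * f n.+1 - \sum_(0 <= s < n.+1) (w (n - s)%N - w (n - s).+1) * f s.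
Proof.
rewrite -[w 0%N * _](subrK (w n.+1 * f 0%N)).
(* The sequence w(n + 1 - s) f(s) telescopes to w(0) f(n + 1) - w(n + 1) f(0). *)
have := telescope_sumr (fun s => w (n.+1 - s)%N * f s) (leq0n n.+1).
rewrite subnn subn0 => <-; rewrite addrAC; congr (_ + _); rewrite -sumrB.
apply: eq_big_nat => s /andP[_ sn]; rewrite subSS subSn// /delta; ring.
Qed.

Lemma nu_increasing_of_weights (R : realType) (nu : R) (w f : nat -> R) :
  0 <= nu -> (forall k, 0 < w k) -> (forall k, w k.+1 <= w k) ->
  w 1%N = (1 - nu) * w 0%N -> 0 <= f 0%N ->
  (forall n, 0 <= \sum_(0 <= s < n.+1) w (n - s)%N * delta f s + w n.+1 * f 0%N) ->
  nu_increasing nu f.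
Proof.
move=> nu0 w0 dw w1 f0 wf.
have step n : (forall s, (s <= n)%N -> 0 <= f s) -> nu * f n <= f n.+1.
  move=> fn; rewrite -(ler_pM2l (w0 0%N)).
  have := wf n; rewrite sum_by_parts_delta subr_ge0; apply: le_trans.
  have w01 : w 0%N - w 1%N = nu * w 0%N by rewrite w1; ring.
  (* The term s = n is exactly nu w(0) f(n); the others are nonnegative and are dropped. *)
  rewrite big_nat_recr//= subnn w01 mulrCA mulrA lerDr big_nat sumr_ge0// => s /andP[_ sn].
  by rewrite mulr_ge0 ?subr_ge0// fn// ltnW.
have fge0 n : forall s, (s <= n)%N -> 0 <= f s.
  elim: n => [s|n IHn s]; first by rewrite leqn0 => /eqP ->.
  rewrite leq_eqVlt => /predU1P[->|]; last by rewrite ltnS; exact: IHn.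
  by apply: le_trans (step n IHn); rewrite mulr_ge0// IHn.
by split=> // n; exact: step (fge0 n).
Qed.

Theorem theorem3p5 (R : realType) (f : nat -> R) (nu : R) :
  0 <= f 0%N ->
  0 < nu < 1 ->
  (forall t : R, NN (1 - nu) t ->
     - (falling t (- nu) / Gamma (1 - nu)) * f 0%N <= Caputo nu f t) ->
  nu_increasing nu f.
Proof.
move=> f0 /andP[nu0 nu1] Hf.
apply: (@nu_increasing_of_weights _ _ (fun k => falling (k%:R - nu) (- nu))) => //.
- exact: ltW.
- by move=> k; exact: falling_natB_gt0.
- move=> k; rewrite falling_natBS// ger_pMl ?falling_natB_gt0//.
  by rewrite gerBl divr_ge0// ltW.
- by rewrite falling_natBS// divr1.
move=> n; have := Hf (1 - nu + n%:R) (ex_intro _ n erefl).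
have G0 : 0 < Gamma (1 - nu) by rewrite Gamma_gt0 ?subr_gt0.
have -> : 1 - nu + n%:R = n.+1%:R - nu by rewrite addrAC nat1r.
rewrite /Caputo.
have -> : n.+1%:R - nu - (1 - nu) = n%:R by rewrite -natr1; ring.
(* The truncation in [Caputo] is exactly n, and the common positive factor 1 / Gamma(1 - nu)
   cancels. *)
rewrite natrK mulNr mulrAC -mulNr mulrC ler_pM2l ?invr_gt0//.
rewrite -subr_ge0 opprK; congr (0 <= _ + _).
(* As s <= n, the truncated difference n - s is the true one, and t - (s + 1) = (n - s) - nu. *)
apply: eq_big_nat => s /andP[_ sn]; congr (falling _ _ * _).
by rewrite natrB// -(natr1 n) -(natr1 s); ring.
Qed.
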